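(* Let $C\subset\mathbb R$ be a Cantor set with $d=\operatorname{diam}(C)>0$, whose largest bounded gap $G$ satisfies $|G|\le0.067\,d$, and whose thickness satisfies $$\tau(C)\ge\frac{1-0.067}{2(0.067)}=6.96268\ldots$$ Then $(0,\,0.435\,d]\subseteq G^3_{AP}(C)$.
   Context: For compact $C\subset\mathbb R$, $G^3_{AP}(C):=\{t>0:\exists x\in\mathbb R\text{ with }x,x+t,x+2t\in C\}$. A bounded gap of $C$ is a bounded connected component of $\mathbb R\setminus C$, and $|E|=\operatorname{diam}(E)$. Thickness $\tau$: a set $P$ is a chunk of $C$ (written $P\propto C$) if $P=C\cap I$ for some closed interval $I$, $P$ is a nonempty proper subset of $C$, and $d(P,C\setminus P)>0$. If $C$ has a chunk, $\tau(C)=\inf_{P\propto C}|P|/d(P,C\setminus P)$; otherwise $\tau(C)=0$ if $C$ is empty or a single point and $\tau(C)=\infty$ if $C$ is an interval of positive length. (This is equivalent to the usual Newhouse bridge/gap thickness.) *)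

(* Defs.v *)
From HB Require Import structures.
From mathcomp Require Import all_boot all_order all_algebra.
From mathcomp Require Import all_classical all_reals all_analysis.
Set Implicit Arguments.
Unset Strict Implicit.
Unset Printing Implicit Defensive.
Import Order.TTheory GRing.Theory Num.Theory.
Import numFieldNormedType.Exports.
Local Open Scope classical_set_scope.
Local Open Scope ring_scope.

(* The real-valued [sup] and [inf] below have value 0 when the supremum or
   infimum does not exist.  [diam] and [set_dist] are used on bounded, resp.
   nonempty, sets only. *)
Definition diam (R : realType) (E : set R) : R :=
  sup [set `|x - y| | x in E & y in E].

Definition set_dist (R : realType) (A B : set R) : R :=
  inf [set `|x - y| | x in A & y in B].

Definition cantor_set (R : realType) (C : set R) : Prop :=
  [/\ C !=set0, compact C, perfect_set C & totally_disconnected C].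

Definition bounded_gap (R : realType) (C G : set R) : Prop :=
  bounded_set G /\ exists2 x, (~` C) x & G = connected_component (~` C) x.

Definition largest_bounded_gap (R : realType) (C G : set R) : Prop :=
  bounded_gap C G /\ forall H, bounded_gap C H -> diam H <= diam G.

Definition chunk (R : realType) (C P : set R) : Prop :=
  [/\ exists a b : R, P = C `&` `[a, b],
      P !=set0,
      P `<` C
    & 0 < set_dist P (C `\` P)].

(* For compact [C], the last branch is reached only by an interval of positive
   length. *)
Definition thickness (R : realType) (C : set R) : \bar R :=
  if `[< exists P, chunk C P >] then
    ereal_inf [set (diam P / set_dist P (C `\` P))%:E | P in chunk C]
  else if `[< C = set0 \/ exists x, C = [set x] >] then 0%E
  else +oo%E.

Definition G3AP (R : realType) (C : set R) : set R :=
  [set t | 0 < t /\ exists x, [/\ C x, C (x + t) & C (x + 2 * t)]].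

(* Main.v *)
(* A progression x, x + t, x + 2t in C is a common point of the translates C,
   C - t and C - 2t. If there is none, finitely many gaps of the translates, each
   coloured by its translate, cover J = [min C, max C - 2t]. Remove them by
   decreasing length, keeping each time a suitable side of what is left. Thickness
   bounds the length of a gap by its distance to any longer gap of its colour, so
   gaps are short near an end of the current interval if that end abuts a removed
   gap of the same colour. The only dangerous gaps are those of the third colour,
   abutting neither end, and they too leave a side of proportion at least 0.23.
   Hence a nondegenerate interval survives, which contradicts the covering. *)
Require Import Defs.
From HB Require Import structures.
From mathcomp Require Import all_boot all_order all_algebra.
From mathcomp Require Import all_classical all_reals all_analysis.
From mathcomp Require Import finmap ring lra.
Import Order.TTheory GRing.Theory Num.Theory.
Import numFieldNormedType.Exports.
Local Open Scope classical_set_scope.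
Local Open Scope ring_scope.

(** * Avoiding finitely many coloured intervals on a line *)

Section ColouredIntervals.
Context {R : realFieldType} {T : eqType}.
Implicit Types (s : seq (T * (R * R))) (U V : T * (R * R)) (p q x : R).

Definition colour U := U.1.
Definition lo U := U.2.1.
Definition hi U := U.2.2.

(* 933/134 = (1 - 0.067) / (2 * 0.067) is the thickness bound. *)
Definition thin_vs (L w : R) := 933 / 134 * w <= L.

(** The form in which thickness enters: the bridge between [U] and [V] is measured against the
    shorter interval [V]. *)
Definition separated s := forall U V, U \in s -> V \in s ->
  U <> V -> colour U = colour V -> hi V - lo V <= hi U - lo U ->
  hi V <= lo U /\ thin_vs (lo U - hi V) (hi V - lo V) \/
  hi U <= lo V /\ thin_vs (lo V - hi U) (hi V - lo V).

(** Inherited from a longer removed interval of colour [c] ending at [p], or from the minimum of the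
    translate of that colour. *)
Definition left_tame c p s := forall U, U \in s -> colour U = c ->
  thin_vs (lo U - p) (hi U - lo U).

Definition right_tame c q s := forall U, U \in s -> colour U = c ->
  thin_vs (q - hi U) (hi U - lo U).

(* The binding constraints on k = 23/100, with T = 933/134, are
   T (1 - 2 k) >= 1/k - 1 + k, which makes the state reproduce itself, and
   T (1 - 2 k) >= 435/130 + k, which makes the initial state admissible. *)
Definition leaves_long_side c p q s := forall U, U \in s -> colour U = c ->
  23 / 100 * (q - p) <= lo U - p \/ 23 / 100 * (q - p) <= q - hi U.

(* The two shapes of interval met along the argument: its ends are adjacent to
   larger intervals of two different colours, resp. of the same colour. *)
Definition state1 c1 c2 c3 p q s :=
  [/\ left_tame c1 p s, right_tame c2 q s & leaves_long_side c3 p q s].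

Definition state2 c p q s :=
  [/\ left_tame c p s, right_tame c q s &
      forall U, U \in s -> thin_vs (q - p) (hi U - lo U)].

Lemma largest_interval s : s != [::] ->
  exists2 U, U \in s & forall V, V \in s -> hi V - lo V <= hi U - lo U.
Proof.
elim: s => //= U s IH _; have [->|/IH[V Vs Vmax]] := eqVneq s [::].
  by exists U => [|V]; rewrite mem_seq1 // => /eqP->.
have [VU|UV] := leP (hi V - lo V) (hi U - lo U).
  exists U => [|W]; first exact: mem_head.
  by rewrite inE => /predU1P[->//|/Vmax/le_trans]; apply.
exists V => [|W]; first by rewrite inE Vs orbT.
by rewrite inE => /predU1P[->|/Vmax//]; exact: ltW.
Qed.

(** Induction removing a longest interval [U]. If [U] meets the current interval, [state1] passes to
    [state2] when [U] has colour [c1] or [c2], and to [state1] with permuted colours when it has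
    colour [c3]; [state2] persists for colour [c1] and otherwise passes to [state1]. *)
Lemma avoid_point s (c1 c2 c3 : T) p q :
  (forall U, U \in s -> lo U < hi U) -> separated s -> p < q ->
  (forall c : T, [\/ c = c1, c = c2 | c = c3]) ->
  state1 c1 c2 c3 p q s \/ state2 c1 p q s ->
  exists2 x, p <= x <= q & forall U, U \in s -> x <= lo U \/ hi U <= x.
Proof.
have [n] := ubnP (size s); elim: n => // n IH in s p q c1 c2 c3 *.
rewrite ltnS => sn s0 seps pq ex st.
have [s_nil|s_nnil] := eqVneq s [::].
  by exists p; rewrite ?lexx ?ltW // => U; rewrite s_nil.
have [U Us Umax] := largest_interval _ s_nnil.
(* Intervals missing the new one are harmless; dropping them also discards those of the colour of
   [U] beyond [U], so that the new end is tame. *)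
pose rest p' q' := [seq V <- s | [&& V != U, lo V < q' & p' < hi V]].
have restP p' q' V : V \in rest p' q' ->
    [/\ V \in s, V <> U, lo V < q', p' < hi V & lo V < hi V].
  by rewrite mem_filter => /andP[/and3P[/eqP ? ? ?] Vs]; split=> //; exact: s0.
have shrink p' q' d1 d2 d3 : p <= p' -> p' < q' -> q' <= q ->
    q' <= lo U \/ hi U <= p' ->
    (forall c : T, [\/ c = d1, c = d2 | c = d3]) ->
    state1 d1 d2 d3 p' q' (rest p' q') \/ state2 d1 p' q' (rest p' q') ->
    exists2 x, p <= x <= q & forall U, U \in s -> x <= lo U \/ hi U <= x.
  move=> pp' p'q' q'q U_out ex' st'.
  have [|V /restP[]//||//|//|x /andP[p'x xq'] x_out] :=
    IH (rest p' q') p' q' d1 d2 d3 _ _ _ _ _ st'.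
  - apply: leq_trans sn; rewrite size_filter -(count_predC (pred1 U) s).
    rewrite -[ltnLHS]add0n -addSn leq_add //; first by rewrite -has_count has_pred1.
    by apply: sub_count => V /and3P[].
  - move=> V W /restP[Vs _ _ _ _] /restP[Ws _ _ _ _]; exact: seps.
  exists x => [|V Vs]; first by apply/andP; split; lra.
  have [->|VU] := eqVneq V U; first by case: U_out => ?; [left|right]; lra.
  have [Vq'|q'V] := ltP (lo V) q'; last by left; lra.
  have [p'V|Vp'] := ltP p' (hi V); last by right; lra.
  by apply: x_out; rewrite mem_filter VU Vq' p'V.
have sepU V : V \in s -> V <> U -> colour V = colour U ->
    hi V <= lo U /\ thin_vs (lo U - hi V) (hi V - lo V) \/
    hi U <= lo V /\ thin_vs (lo V - hi U) (hi V - lo V).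
  by move=> Vs VU cVU; apply: seps => //; [move=> UV; exact: VU|exact: Umax].
have U0 := s0 _ Us.
have left_part d : colour U = d -> right_tame d (lo U) (rest p (lo U)).
  move=> Ud V /restP[Vs VU Vlo _ V0] Vd.
  by have [[]//|[? _]] := sepU V Vs VU (etrans Vd (esym Ud)); lra.
have right_part d : colour U = d -> left_tame d (hi U) (rest (hi U) q).
  move=> Ud V /restP[Vs VU _ Vhi V0] Vd.
  by have [[? _]|[]//] := sepU V Vs VU (etrans Vd (esym Ud)); lra.
have subL c p' q' : left_tame c p s -> left_tame c p (rest p' q').
  by move=> tame V /restP[Vs _ _ _ _]; exact: tame.
have subR c p' q' : right_tame c q s -> right_tame c q (rest p' q').
  by move=> tame V /restP[Vs _ _ _ _]; exact: tame.
have subI p' q' : thin_vs (q' - p') (hi U - lo U) ->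
    forall V, V \in rest p' q' -> thin_vs (q' - p') (hi V - lo V).
  by rewrite /thin_vs => UI V /restP[/Umax]; lra.
have [qU|Uq] := leP q (lo U).
  apply: (shrink p q c1 c2 c3) => //; [by left|case: st => -[t1 t2 t3]].
    left; split; [exact: subL|exact: subR|].
    by move=> V /restP[Vs _ _ _ _]; exact: t3.
  right; split; [exact: subL|exact: subR|].
  by move=> V /restP[Vs _ _ _ _]; exact: t3.
have [Up|pU] := leP (hi U) p.
  apply: (shrink p q c1 c2 c3) => //; [by right|case: st => -[t1 t2 t3]].
    left; split; [exact: subL|exact: subR|].
    by move=> V /restP[Vs _ _ _ _]; exact: t3.
  right; split; [exact: subL|exact: subR|].
  by move=> V /restP[Vs _ _ _ _]; exact: t3.
case: st => -[t1 t2 t3].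
- have [Uc|Uc|Uc] := ex (colour U).
  (* By tameness at [p], the left piece is at least 933/134 times as long as [U], hence as any
     remaining interval. *)
  + have := t1 U Us Uc; rewrite /thin_vs => hU.
    apply: (shrink p (lo U) c1 c2 c3) => //; try lra.
    right; split; [exact: subL|exact: left_part|exact: subI].
  + have := t2 U Us Uc; rewrite /thin_vs => hU.
    apply: (shrink (hi U) q c2 c1 c3) => //; try lra.
      by move=> c; case: (ex c) => ->; [constructor 2|constructor 1|constructor 3].
    right; split; [exact: right_part|exact: subR|exact: subI].
  + case: (t3 U Us Uc) => hU.
    * apply: (shrink p (lo U) c1 c3 c2) => //; try lra.
        by move=> c; case: (ex c) => ->; [constructor 1|constructor 3|constructor 2].
      left; split; [exact: subL|exact: left_part|].
      (* Put l = [lo U - p], so [q - p] is at most l / 0.23. A violating [V] is longer than 0.54 l,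
         while [q - hi V] is below (1/0.23 - 0.77) l < 3.58 l; but 933/134 * 0.54 > 3.75. *)
      move=> V /restP[Vs _ VU pV V0] Vc; have := t2 V Vs Vc; rewrite /thin_vs => hV.
      have [|?] := leP (23 / 100 * (lo U - p)) (lo V - p); first by left.
      by right; lra.
    * apply: (shrink (hi U) q c3 c2 c1) => //; try lra.
        by move=> c; case: (ex c) => ->; [constructor 3|constructor 2|constructor 1].
      left; split; [exact: right_part|exact: subR|].
      move=> V /restP[Vs _ VU pV V0] Vc; have := t1 V Vs Vc; rewrite /thin_vs => hV.
      have [|?] := leP (23 / 100 * (q - hi U)) (q - hi V); first by right.
      by left; lra.
- have halve c : colour U = c -> c = c2 \/ c = c3 ->
    exists2 x, p <= x <= q & forall U, U \in s -> x <= lo U \/ hi U <= x.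
    move=> Uc cE; have := t3 U Us; rewrite /thin_vs => hU.
    have [c' ex'] : exists c', forall d, [\/ d = c1, d = c | d = c'].
      case: cE => ->; [by exists c3|exists c2] => d.
      by case: (ex d) => ->; [constructor 1|constructor 3|constructor 2].
    (* Such a piece is at least (933/134 - 1)/2 > 2.9 times as long as [U], so an interval no longer
       than [U] cannot come within 23% of both ends. *)
    have small p' q' : q' - p' >= (q - p - (hi U - lo U)) / 2 ->
        leaves_long_side c' p' q' (rest p' q').
      move=> pq' V /restP[/Umax VU _ _ _ _] _.
      have [|?] := leP (23 / 100 * (q' - p')) (lo V - p'); first by left.
      by right; lra.
    have [UL|UR] := leP (q - hi U) (lo U - p).
      apply: (shrink p (lo U) c1 c c') => //; try lra.
      by left; split; [exact: subL|exact: left_part|apply: small; lra].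
    apply: (shrink (hi U) q c c1 c') => //; try lra.
      by move=> d; case: (ex' d) => ->; [constructor 2|constructor 1|constructor 3].
    by left; split; [exact: right_part|exact: subR|apply: small; lra].
  have [Uc|Uc|Uc] := ex (colour U); [|by apply: (halve c2); [|left]|
    by apply: (halve c3); [|right]].
  have := t1 U Us Uc; rewrite /thin_vs => hU.
  apply: (shrink p (lo U) c1 c2 c3) => //; try lra.
  by right; split; [exact: subL|exact: left_part|exact: subI].
Qed.

End ColouredIntervals.

(** * Gaps and bridges of a closed set *)

Lemma closed_sup_mem {R : realType} (A : set R) : closed A -> A !=set0 -> has_ubound A -> A (sup A).
Proof.
move=> clA A0 ubA; have := closure_sup A0 ubA.
by rewrite -(proj1 (closure_id A)).
Qed.

Lemma closed_inf_mem {R : realType} (A : set R) : closed A -> A !=set0 -> has_lbound A -> A (inf A).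
Proof.
move=> clA A0 lbA; apply: itv_closed_infimums => //; split.
  exact: ge_inf.
by move=> x; exact: lb_le_inf.
Qed.

Section Gaps.
Context {R : realType} (C : set R).

Lemma thickness_le_chunk (T : R) (P : set R) : (T%:E <= thickness C)%E -> chunk C P ->
  T * set_dist P (C `\` P) <= diam P.
Proof.
move=> + chP; rewrite /thickness; case: ifPn => [_ TC|/asboolPn]; last first.
  by case; exists P.
have [_ _ _ dP0] := chP.
rewrite -ler_pdivlMr // -lee_fin (le_trans TC) //.
by apply: ereal_inf_lbound; exists P.
Qed.

(** The part of [C] in [[p, q]] is a chunk: [z] makes it proper, and [e] bounds its distance to the
    rest from below. *)
Lemma thickness_bridge (T p q e : R) : 0 <= T -> (T%:E <= thickness C)%E ->
  p <= q -> C p -> C q -> 0 < e ->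
  (forall x, C x -> x < p -> x <= p - e) ->
  (forall x, C x -> q < x -> q + e <= x) ->
  (exists2 x, C x & x < p \/ q < x) -> T * e <= q - p.
Proof.
move=> T0 TC pq Cp Cq e0 Cltp Cgtq [z Cz zout].
pose P := C `&` `[p, q].
have P_itv x : P x -> p <= x <= q by move=> [_]; rewrite /= in_itv.
have Pp : P p by split=> //=; rewrite in_itv /= lexx.
have CPz : (C `\` P) z by split=> // /P_itv/andP[]; case: zout; lra.
have e_le : e <= set_dist P (C `\` P).
  apply: lb_le_inf => [|_ [x /P_itv/andP[px xq] [y [Cy nPy] <-]]].
    by exists `|p - z|, p => //; exists z.
  have [yp|py] := ltP y p.
    by have := Cltp y Cy yp; rewrite ler_normr => ?; apply/orP; left; lra.
  have [qy|yq] := ltP q y.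
    by have := Cgtq y Cy qy; rewrite ler_normr => ?; apply/orP; right; lra.
  by case: nPy; split=> //=; rewrite in_itv /= py.
have chP : chunk C P.
  split; [by exists p, q|by exists p| |exact: lt_le_trans e_le].
  split; first exact: subIsetl.
  by move=> /(_ z Cz); case: CPz.
have dP : diam P <= q - p.
  apply: ge_sup => [|_ [x /P_itv/andP[? ?] [y /P_itv/andP[? ?] <-]]].
    by exists `|p - p|, p => //; exists p.
  by rewrite ler_norml; apply/andP; split; lra.
exact: le_trans (ler_wpM2l T0 e_le) (le_trans (thickness_le_chunk _ _ TC chP) dP).
Qed.

Definition gap (a b : R) := [/\ C a, C b, a < b & forall x, C x -> x <= a \/ b <= x].

(** The bridge between the two gaps is bordered by gaps of length at least [b' - a'], which serves
    as [e]. *)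
Lemma gap_separated (T a b a' b' : R) : 0 <= T -> (T%:E <= thickness C)%E ->
  gap a b -> gap a' b' -> (a, b) <> (a', b') -> b' - a' <= b - a ->
  b' <= a /\ T * (b' - a') <= a - b' \/ b <= a' /\ T * (b' - a') <= a' - b.
Proof.
move=> T0 TC [Ca Cb ab gab] [Ca' Cb' ab' gab'] ne le_len.
case: (gab _ Cb') => [b'a|bb'].
  left; split=> //; apply: thickness_bridge => //; first by lra.
  - by move=> x /gab'[] ?; lra.
  - by move=> x /gab[] ?; lra.
  - by exists a' => //; left; lra.
case: (gab _ Ca') => [a'a|ba'].
  case: ne; congr pair.
    by case: (gab' _ Ca) => ?; lra.
  by case: (gab' _ Cb) => ?; lra.
right; split=> //; apply: thickness_bridge => //; first by lra.
- by move=> x /gab[] ?; lra.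
- by move=> x /gab'[] ?; lra.
- by exists b' => //; right; lra.
Qed.

(** The bridge starting at the minimum has a gap on its right only. This yields tameness at the left
    end of the initial interval. *)
Lemma gap_left_bridge (T a b m : R) : 0 <= T -> (T%:E <= thickness C)%E ->
  gap a b -> C m -> (forall x, C x -> m <= x) -> T * (b - a) <= a - m.
Proof.
move=> T0 TC [Ca Cb ab gab] Cm lem; apply: thickness_bridge => //; first exact: lem.
- by lra.
- by move=> x /lem; lra.
- by move=> x /gab[] ?; lra.
- by exists b => //; right.
Qed.

Lemma gap_right_bridge (T a b M : R) : 0 <= T -> (T%:E <= thickness C)%E ->
  gap a b -> C M -> (forall x, C x -> x <= M) -> T * (b - a) <= M - b.
Proof.
move=> T0 TC [Ca Cb ab gab] CM leM; apply: thickness_bridge => //; first exact: leM.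
- by lra.
- by move=> x /gab[] ?; lra.
- by move=> x /leM; lra.
- by exists a => //; left.
Qed.

Lemma closed_gap (a b y : R) : closed C -> C a -> C b -> a <= y <= b -> ~ C y ->
  exists a' b', gap a' b' /\ a' < y < b'.
Proof.
move=> clC Ca Cb /andP[ay yb] nCy.
pose A := C `&` [set x | x <= y]; pose B := C `&` [set x | y <= x].
have [CA Ay] : A (sup A).
  apply: closed_sup_mem; [by apply: closedI => //; exact: closed_le|by exists a|].
  by exists y => x [].
have [CB By] : B (inf B).
  apply: closed_inf_mem; [by apply: closedI => //; exact: closed_ge|by exists b|].
  by exists y => x [].
have Ay' : sup A < y by rewrite lt_neqAle Ay andbT; apply/eqP => E; rewrite E in CA.
have By' : y < inf B by rewrite lt_neqAle By andbT; apply/eqP => E; rewrite -E in CB.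
exists (sup A), (inf B); split; last by rewrite Ay'.
split=> //; first exact: lt_trans By'.
move=> x Cx; have [xy|yx] := leP x y; [left|right].
  by apply: ub_le_sup => //; exists y => z [].
by apply: ge_inf; [exists y => z []|split=> //=; exact: ltW].
Qed.

End Gaps.

(** * Progressions as common points of three translates *)

Theorem theorem4p1 (R : realType) (C G : set R) (d : R)
    (hC : cantor_set C) (hd : d = diam C) (hd0 : 0 < d)
    (hG : largest_bounded_gap C G) (hGd : diam G <= 67 / 1000 * d)
    (htau : (((1 - 67 / 1000) / (2 * (67 / 1000)))%:E <= thickness C)%E) :
  `]0, 435 / 1000 * d] `<=` G3AP C.
Proof.
have [C0 cC _ _] := hC.
have clC : closed C by exact: compact_closed (@Rhausdorff R) cC.
have [M [_ /(_ (M + 1) (ltr_pwDr ltr01 (lexx M))) CM]] := compact_bounded cC.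
have {}CM x : C x -> - (M + 1) <= x <= M + 1 by move/CM; rewrite /= ler_norml.
have ubC : has_ubound C by exists (M + 1) => x /CM/andP[].
have lbC : has_lbound C by exists (- (M + 1)) => x /CM/andP[].
pose m := inf C; pose L := sup C.
have Cm : C m by exact: closed_inf_mem.
have CL : C L by exact: closed_sup_mem.
have lem x : C x -> m <= x by exact: ge_inf.
have leL x : C x -> x <= L by exact: ub_le_sup.
have dL : d <= L - m.
  rewrite hd; apply: ge_sup => [|_ [x /[dup] /lem ? /leL ? [y /[dup] /lem ? /leL ? <-]]].
    by exists `|m - m|, m => //; exists m.
  by rewrite ler_norml; apply/andP; split; lra.
have TC : ((933 / 134 : R)%:E <= thickness C)%E.
  by move: htau; congr (_%:E <= _)%E; field.
have T0 : 0 <= 933 / 134 :> R by lra.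
move=> t; rewrite /= in_itv /= => /andP[t0 td]; split=> //; apply: contrapT => noAP.
(* Colour i marks the gaps of the translate C - i t. *)
pose D := [set U : 'I_3 * (R * R) | gap C (lo U + (colour U)%:R * t)
  (hi U + (colour U)%:R * t)].
have coverJ : `[m, L - 2 * t] `<=` cover D (fun U => [set` `]lo U, hi U[]).
  move=> x; rewrite /= in_itv /= => /andP[mx xL].
  have [i nC] : exists i : 'I_3, ~ C (x + i%:R * t).
    apply: contrapT => /forallNP allC; apply: noAP; exists x.
    have {}allC (i : 'I_3) : C (x + i%:R * t) by apply: contrapT; exact: allC.
    split; [have := allC (inord 0)|have := allC (inord 1)|have := allC (inord 2)];
    by rewrite inordK // ?mul0r ?addr0 ?mul1r.
  have it : 0 <= i%:R * t <= 2 * t.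
    rewrite mulr_ge0 ?ler0n ?(ltW t0) //= ler_wpM2r ?(ltW t0) //.
    by rewrite ler_nat -ltnS.
  have xit : m <= x + i%:R * t <= L.
    by case/andP: it => ? ?; apply/andP; split; lra.
  have [a [b [gab /andP[ax xb]]]] := closed_gap C _ _ _ clC Cm CL xit nC.
  exists (i, (a - i%:R * t, b - i%:R * t)); rewrite /D /lo /hi /colour /=.
    by rewrite !subrK.
  by rewrite in_itv /= ltrBlDr ltrBrDr ax.
have := @segment_compact R m (L - 2 * t); rewrite compact_cover.
move=> /(_ _ D _ (fun U _ => itv_open _ _) coverJ) [s sD sJ].
have {}sD U : U \in s -> D U by move=> /sD/set_mem.
have D0 U : D U -> lo U < hi U by case=> _ _; rewrite ltrD2r.
have DL U : D U -> thin_vs (lo U + (colour U)%:R * t - m) (hi U - lo U).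
  move=> /gap_left_bridge => /(_ _ _ T0 TC Cm lem).
  by rewrite /thin_vs; lra.
have DR U : D U -> thin_vs (L - (hi U + (colour U)%:R * t)) (hi U - lo U).
  move=> /gap_right_bridge => /(_ _ _ T0 TC CL leL).
  by rewrite /thin_vs; lra.
(* C starts at [m] and C - 2t ends at [L - 2 * t], so colours 0 and 2 are tame at the two ends and
   the middle translate is the third colour. *)
have [|||c||x xJ x_out] := avoid_point s (inord 0 : 'I_3) (inord 2) (inord 1) m (L - 2 * t).
- by move=> U /sD /D0.
- move=> U V /sD DU /sD DV UV cUV le_len.
  have := gap_separated _ _ _ _ _ _ T0 TC DU DV.
  rewrite -cUV => H.
  case: H; [..|left|right].
  + case: U V UV cUV {DU DV le_len} => [c [a b]] [c' [a' b']] /= UV cc [/addIr ea /addIr eb].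
    apply: UV; congr pair; [exact: cc|congr pair; [exact: ea|exact: eb]].
  + by move: le_len; lra.
  + by rewrite /thin_vs; lra.
  + by rewrite /thin_vs; lra.
- by lra.
- case: c => [[|[|[|//]]]] lt3; [constructor 1|constructor 3|constructor 2];
  by apply: val_inj; rewrite /= inordK.
- left; split=> U /sD DU cU; have := DL _ DU; have := DR _ DU; rewrite /thin_vs cU inordK //.
  + by lra.
  + by lra.
  (* With l = [L - 2 * t - m], the bound on [t] gives t <= (435/130) l. A violating [U] is longer
     than 0.54 l, yet its bridge [lo U + t - m] is below (435/130 + 0.23) l < 3.58 l. *)
  + have [|?] := leP (23 / 100 * (L - 2 * t - m)) (lo U - m); first by left.
    by right; lra.
have [U sU /=] := sJ x xJ.
by rewrite in_itv /= => /andP[Ux xU]; case: (x_out U sU) => ?; lra.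
Qed.
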